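(* Let $\sigma>0$, $k\ge0$, $L\ge2$. The generator of the ABEP$(\sigma,k)$ process on $\{1,\dots,L\}$ with closed boundary conditions can be written (on smooth functions) as $$\mathcal L^{ABEP(\sigma,k)}=\sum_{i=1}^{L-1}\Big(\tilde K_i^+\tilde K_{i+1}^-+\tilde K_i^-\tilde K_{i+1}^+-2\tilde K_i^o\tilde K_{i+1}^o+2k^2\Big),$$ where the operators $\tilde K_i^a$, $a\in\{+,-,o\}$, are defined by $$(\tilde K_i^af)(x)=\big(K_i^a(f\circ g^{-1})\big)(g(x)),$$ and the operators $\tilde K_i^a$, $a\in\{+,-,o\}$, provide a representation of the $\mathfrak{su}(1,1)$ Lie algebra, i.e. they satisfy $[\tilde K_i^o,\tilde K_i^\pm]=\pm\tilde K_i^\pm$, $[\tilde K_i^-,\tilde K_i^+]=2\tilde K_i^o$ (and operators with different site indices commute).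
   Context: The generator of ABEP$(\sigma,k)$ acts on smooth $f:[0,\infty)^L\to\mathbb R$ as $\mathcal L^{ABEP(\sigma,k)}=\sum_{i=1}^{L-1}\mathcal L^{ABEP}_{i,i+1}$, $$\mathcal L^{ABEP}_{i,i+1}f(x)=\tfrac1{4\sigma^2}(1-e^{-2\sigma x_i})(e^{2\sigma x_{i+1}}-1)\Big(\tfrac{\partial}{\partial x_i}-\tfrac{\partial}{\partial x_{i+1}}\Big)^2f(x)-\tfrac1{2\sigma}\Big\{(1-e^{-2\sigma x_i})(e^{2\sigma x_{i+1}}-1)+2k\big(2-e^{-2\sigma x_i}-e^{2\sigma x_{i+1}}\big)\Big\}\Big(\tfrac{\partial}{\partial x_i}-\tfrac{\partial}{\partial x_{i+1}}\Big)f(x).$$ With $E_i(x)=\sum_{\ell=i}^Lx_\ell$, $E_{L+1}(x)=0$, the map $g:[0,\infty)^L\to g([0,\infty)^L)\subset[0,\infty)^L$ is the bijection onto its image given by $g_i(x)=\frac{e^{-2\sigma E_{i+1}(x)}-e^{-2\sigma E_i(x)}}{2\sigma}$, with inverse $(g^{-1}(z))_i=\frac1{2\sigma}\ln\frac{1-2\sigma\sum_{j=i+1}^Lz_j}{1-2\sigma\sum_{j=i}^Lz_j}$. The operators $K_i^a$ act on smooth functions of $z=(z_1,\dots,z_L)$ by $$K_i^+=z_i,\qquad K_i^-=z_i\frac{\partial^2}{\partial z_i^2}+2k\frac{\partial}{\partial z_i},\qquad K_i^o=z_i\frac{\partial}{\partial z_i}+k .$$ *)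

(* Defs.v *)
From HB Require Import structures.
From mathcomp Require Import all_boot all_order all_algebra.
From mathcomp Require Import all_classical all_reals all_analysis.

Set Implicit Arguments.
Unset Strict Implicit.
Unset Printing Implicit Defensive.

Import Order.TTheory GRing.Theory Num.Theory.
Import numFieldNormedType.Exports.

Local Open Scope classical_set_scope.
Local Open Scope ring_scope.

Section SmoothOn.
Variables (R : realType) (L : nat).
Implicit Types (A : set 'rV[R]_L) (f : 'rV[R]_L -> R) (i : 'I_L).

(* A real function on A is represented by a total function whose values
   outside A are irrelevant: increments leaving A are discarded, so at a
   boundary point of an orthant the derivatives are one-sided. *)
Definition partial_quotient f i (x : 'rV[R]_L) (h : R) : R :=
  h^-1 * (f (x + h *: delta_mx 0 i) - f x).

Definition increments A i (x : 'rV[R]_L) : set_system R :=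
  within [set h | A (x + h *: delta_mx 0 i)] 0^'.

Definition partial A i f (x : 'rV[R]_L) : R :=
  lim (partial_quotient f i x @ increments A i x).

Definition has_partial A i f (x : 'rV[R]_L) : Prop :=
  cvg (partial_quotient f i x @ increments A i x).

Fixpoint C_n A (n : nat) f : Prop :=
  {within A, continuous f} /\
  match n with
  | 0 => True
  | m.+1 => forall i, (forall x, A x -> has_partial A i f x) /\
                      C_n A m (partial A i f)
  end.

Definition smooth_on A f : Prop := forall n, C_n A n f.

End SmoothOn.

Section Operators.
Variables (R : realType) (L : nat).
Local Notation V := 'rV[R]_L.
Local Notation operator := ((V -> R) -> V -> R).

Definition orthant : set V := [set x | forall i, 0 <= x 0 i].

(* Sites are numbered from 0, and tail_sum x i is the sum of the coordinates
   of index at least i; i is a nat so that i = L gives the empty sum. *)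
Definition tail_sum (x : V) (i : nat) : R := \sum_(l < L | (i <= l)%N) x 0 l.

Definition g (sigma : R) (x : V) : V :=
  \row_i ((expR (- (2 * sigma * tail_sum x i.+1))
           - expR (- (2 * sigma * tail_sum x i))) / (2 * sigma)).

Definition g_inv (sigma : R) (z : V) : V :=
  \row_i (ln ((1 - 2 * sigma * tail_sum z i.+1)
              / (1 - 2 * sigma * tail_sum z i)) / (2 * sigma)).

Lemma tail_sum_rec (x : V) (i : 'I_L) :
  tail_sum x i = x 0 i + tail_sum x i.+1.
Proof.
rewrite /tail_sum (bigD1 i) //=; congr (_ + _); apply: eq_bigl => l.
by rewrite ltn_neqAle andbC eq_sym.
Qed.

Lemma tail_sum_ge (x : V) (i : nat) : (L <= i)%N -> tail_sum x i = 0.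
Proof.
move=> Li; rewrite /tail_sum big_pred0 // => l.
by apply/negbTE; rewrite -ltnNge (leq_trans (ltn_ord l)).
Qed.

Lemma tail_sum_g (sigma : R) (x : V) (i : nat) : 0 < sigma ->
  1 - 2 * sigma * tail_sum (g sigma x) i = expR (- (2 * sigma * tail_sum x i)).
Proof.
move=> s0; have [m] := ubnP (L - i); elim: m i => // m IH i.
rewrite ltnS => iLm; have [Li|iL] := leqP L i.
  by rewrite !tail_sum_ge // !mulr0 subr0 oppr0 expR0.
have {}IH := IH i.+1 _; rewrite subnS in IH.
have Lm : ((L - i).-1 < m)%N by rewrite (leq_trans _ iLm) // ltn_predL subn_gt0.
rewrite -[i]/(nat_of_ord (Ordinal iL)) tail_sum_rec mxE mulrDr opprD addrCA.
rewrite (IH Lm) /= [2 * sigma * (_ / _)]mulrC divfK; last first.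
  by rewrite mulf_neq0 ?gt_eqF.
by rewrite opprB subrK.
Qed.

Lemma g_invK (sigma : R) (x : V) : 0 < sigma -> g_inv sigma (g sigma x) = x.
Proof.
move=> s0; apply/rowP => i; rewrite mxE !tail_sum_g // -expRN opprK -expRD expRK.
rewrite addrC -mulrBr tail_sum_rec addrK mulrC mulKf //.
by rewrite mulf_neq0 ?gt_eqF.
Qed.

Definition g_image (sigma : R) : set V := g sigma @` orthant.

Definition partial_diff (A : set V) (i j : 'I_L) : operator :=
  fun f x => partial A i f x - partial A j f x.

Definition ABEP_bond (sigma k : R) (i j : 'I_L) : operator := fun f x =>
  let D := partial_diff orthant i j in
  let u := expR (- (2 * sigma * x 0 i)) in
  let v := expR (2 * sigma * x 0 j) in
  (4 * sigma ^+ 2)^-1 * (1 - u) * (v - 1) * D (D f) x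
  - (2 * sigma)^-1 * ((1 - u) * (v - 1) + 2 * k * (2 - u - v)) * D f x.

Definition ABEP_generator (sigma k : R) : operator := fun f x =>
  \sum_(i < L) \sum_(j < L | j == i.+1 :> nat) ABEP_bond sigma k i j f x.

Inductive su11_generator : Type := Kplus | Kminus | Ko.

Definition K_op (A : set V) (k : R) (a : su11_generator) (i : 'I_L) :
    operator := fun phi z =>
  match a with
  | Kplus => z 0 i * phi z
  | Kminus => z 0 i * partial A i (partial A i phi) z
              + 2 * k * partial A i phi z
  | Ko => z 0 i * partial A i phi z + k * phi z
  end.

Definition K_tilde (sigma k : R) (a : su11_generator) (i : 'I_L) : operator :=
  fun f x => K_op (g_image sigma) k a i (f \o g_inv sigma) (g sigma x).

Definition commutator (S T : operator) : operator :=
  fun f x => S (T f) x - T (S f) x.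

Definition eq_on_smooth (A : set V) (S T : operator) : Prop :=
  forall f, smooth_on A f -> {in A, S f =1 T f}.

Definition linear_on_smooth (A : set V) (T : operator) : Prop :=
  (forall f, smooth_on A f -> smooth_on A (T f)) /\
  (forall (c : R) f h, smooth_on A f -> smooth_on A h ->
     {in A, T (fun x => c * f x + h x) =1 (fun x => c * T f x + T h x)}).

Definition su11_representation (A : set V)
    (K : su11_generator -> 'I_L -> operator) : Prop :=
  [/\ forall a i, linear_on_smooth A (K a i),
      forall i, eq_on_smooth A (commutator (K Ko i) (K Kplus i)) (K Kplus i),
      forall i, eq_on_smooth A (commutator (K Ko i) (K Kminus i))
                               (fun f x => - K Kminus i f x),
      forall i, eq_on_smooth A (commutator (K Kminus i) (K Kplus i))
                               (fun f x => 2 * K Ko i f x)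
    & forall a b i j, i != j ->
        eq_on_smooth A (commutator (K a i) (K b j)) (fun _ _ => 0)].

End Operators.

Arguments orthant {R L}.

(* Main.v *)
(* Let D_i be the derivative with respect to z_i, pulled back to x by g.  With
   E_m the tail sums and a_i(m) = [m <= i] exp (2 sigma E_m), the chain rule gives
     D_i = sum_l (a_i(l) - a_i(l+1)) d/dx_l,
   and telescoping gives D_i (exp (c E_m)) = c exp (c E_m) a_i(m).  Hence
   D_i g_j = delta_ij, and since D_i a_j(m) = 2 sigma a_i(m) a_j(m) is symmetric
   in i and j, the D_i commute by Schwarz's theorem.  The su(1,1) relations
   are then algebra in commuting derivations, and the bond generators match
   because D_{i+1} - D_i = exp (2 sigma E_{i+1}) (d/dx_{i+1} - d/dx_i).
   Derivatives on the boundary are one-sided, so the mean value, Schwarz and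
   chain rules are proved on the closed orthant with axis-parallel segments. *)

Require Import Defs.
From HB Require Import structures.
From mathcomp Require Import all_boot all_order all_algebra.
From mathcomp Require Import all_classical all_reals all_analysis.
From mathcomp Require Import ring lra.

Set Implicit Arguments.
Unset Strict Implicit.
Unset Printing Implicit Defensive.

Import Order.TTheory GRing.Theory Num.Theory.
Import numFieldNormedType.Exports.

Local Open Scope classical_set_scope.
Local Open Scope ring_scope.

(** * One-sided partial derivatives as limits along admissible increments *)

Section PartialDerivatives.
Variables (R : realType) (L : nat).
Local Notation V := 'rV[R]_L.
Implicit Types (A : set V) (f h : V -> R) (x : V) (i l : 'I_L).

(** Existence and value of the derivative in one relation; [partial] is a [lim] and is informative
    only once convergence is known. *)
Definition is_partial A i f x (d : R) : Prop :=
  partial_quotient f i x @ increments A i x --> d.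

Lemma coord_move x (t : R) i l :
  (x + t *: delta_mx 0 i) 0 l = x 0 l + t * (l == i)%:R.
Proof. by rewrite !mxE eqxx. Qed.

Lemma orthant_move x (t : R) i : orthant x ->
  orthant (x + t *: delta_mx 0 i) <-> 0 <= x 0 i + t.
Proof.
move=> Ox; split=> [/(_ i)|xt l]; first by rewrite coord_move eqxx mulr1.
by rewrite coord_move; case: eqP => [->|_]; rewrite ?mulr1// mulr0 addr0.
Qed.

Lemma increments_filter A i x : Filter (increments A i x).
Proof. exact: within_filter. Qed.

(** Properness makes limits of difference quotients unique. Small positive increments suffice for
    it, and these remain available at boundary points of the orthant and of the image of [g]. *)
Lemma increments_proper A i x :
  (\forall t \near 0^'+, A (x + t *: delta_mx 0 i)) ->
  ProperFilter (increments A i x).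
Proof.
move=> nA; split; last exact: increments_filter.
rewrite /increments /dnbhs /within => /nbhs_ballP[d /= d0 H].
move: nA; rewrite /at_right /within => /nbhs_ballP[c /= c0 {}nA].
pose t := Num.min c d / 2.
have t0 : 0 < t by rewrite divr_gt0// lt_min c0.
have /andP[tc td] : (t < c) && (t < d).
  by rewrite -lt_min /t ltr_pdivrMr// ltr_pMr ?ltr1n// lt_min c0.
apply: (H t); first by rewrite -ball_normE /ball_ /= sub0r normrN gtr0_norm.
  by rewrite gt_eqF.
by apply: nA => //; rewrite -ball_normE /ball_ /= sub0r normrN gtr0_norm.
Qed.

Lemma incrementsP A i x (P : set R) : increments A i x P <->
  exists2 d, 0 < d & forall t, t != 0 -> `|t| < d ->
    A (x + t *: delta_mx 0 i) -> P t.
Proof.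
rewrite /increments /dnbhs /within; split.
  move=> /nbhs_ballP[d /= d0 H]; exists d => // t t0 td At; apply: H => //.
  by rewrite -ball_normE /ball_ /= sub0r normrN.
move=> [d d0 H]; apply/nbhs_ballP; exists d => //= t.
by rewrite -ball_normE /ball_ /= sub0r normrN => td t0 At; apply: H.
Qed.

Lemma cvg_incrementsP A i x (q : R -> R) (c : R) :
  q @ increments A i x --> c <->
  forall e, 0 < e -> exists2 d, 0 < d & forall t, t != 0 -> `|t| < d ->
    A (x + t *: delta_mx 0 i) -> `|c - q t| < e.
Proof.
have FF := increments_filter A i x.
split=> [/cvgrPdist_lt H e e0|H].
  exact/incrementsP/H.
apply/cvgrPdist_lt => e e0; exact/incrementsP/H.
Qed.

(** Balls of row vectors are products of balls, so nearness can be measured coordinate by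
    coordinate. *)
Lemma within_cvgP A f x : f @ within A (nbhs x) --> f x <->
  forall e, 0 < e -> exists2 d, 0 < d & forall y, A y ->
    (forall l, `|x 0 l - y 0 l| < d) -> `|f x - f y| < e.
Proof.
split.
  move=> /cvgrPdist_lt H e e0; have {H} := H e e0.
  rewrite /within => /nbhs_ballP[d d0 H]; exists d => // y Ay xy.
  apply: H => //; split=> // i j; rewrite ord1; exact: xy.
move=> H; apply/cvgrPdist_lt => e /H[d d0 {}H].
rewrite /within; apply/nbhs_ballP; exists d => // y [_ xy] Ay.
apply: H => // l; exact: xy.
Qed.

Lemma within_continuousP A f : {within A, continuous f} <->
  forall x, A x -> f @ within A (nbhs x) --> f x.
Proof. exact: subspace_continuousP. Qed.

End PartialDerivatives.

(** * Differentiation rules for partial derivatives relative to a set *)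

Section PartialCalculus.
Variables (R : realType) (L : nat).
Local Notation V := 'rV[R]_L.
Implicit Types (A : set V) (f h : V -> R) (x : V) (i l : 'I_L).

#[local] Existing Instance increments_filter.

(** A limit over all nonzero increments survives restriction to those that stay in [A]. Functions
    given by a formula valid across the boundary are differentiated this way. *)
Lemma is_derive_increments A i x (phi : R -> R) (d : R) :
  is_derive (0 : R) 1 phi d ->
  (fun t => t^-1 * (phi t - phi 0)) @ increments A i x --> d.
Proof.
move=> [dphi dE].
have : (fun t : R => t^-1 *: ((phi \o shift 0) (t *: 1) - phi 0)) @ 0^' --> d.
  by rewrite -dE; exact: dphi.
rewrite (_ : (fun _ => _) = (fun t => t^-1 * (phi t - phi 0))).
  by move=> H; exact: (cvg_within_filter _ H).
by apply/funext => t; rewrite /= /GRing.scale/= mulr1 addr0.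
Qed.

Lemma is_derive_is_partial A f i x (d : R) :
  is_derive (0 : R) 1 (fun t => f (x + t *: delta_mx 0 i)) d ->
  is_partial A i f x d.
Proof.
move=> /(is_derive_increments A i x).
by rewrite /is_partial /partial_quotient scale0r addr0.
Qed.

Lemma is_partial_ext A f h i x (d : R) : A x -> (forall y, A y -> f y = h y) ->
  is_partial A i f x d -> is_partial A i h x d.
Proof.
move=> Ax fh /cvg_incrementsP H; apply/cvg_incrementsP => e /H[c c0 {}H].
by exists c => // t t0 tc At; rewrite /partial_quotient -!fh//; exact: H.
Qed.

(** The two [lim]s choose from the same set of limits, so they agree even at points without a
    derivative. *)
Lemma partial_ext A f h i x : A x -> (forall y, A y -> f y = h y) ->
  partial A i f x = partial A i h x.
Proof.
move=> Ax fh; rewrite /partial /lim /lim_in; congr get.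
apply/funext => d; apply/propext.
split=> [|]; first exact: is_partial_ext.
by apply: is_partial_ext => // y /fh.
Qed.

Lemma orthant_increments_proper i x :
  orthant x -> ProperFilter (increments orthant i x).
Proof.
move=> Ox; apply: increments_proper; near=> t; apply/orthant_move => //.
by rewrite addr_ge0//; near: t; exact: nbhs_right_ge.
Unshelve. all: by end_near. Qed.

(** Differentiability gives continuity along the axis, because the increment of [f] is [t] times a
    convergent quotient. The product rule relies on this. *)
Lemma is_partial_cvg A f i x (d : R) : is_partial A i f x d ->
  (fun t => f (x + t *: delta_mx 0 i)) @ increments A i x --> f x.
Proof.
move=> H.
have t0 : (fun t : R => t) @ increments A i x --> (0 : R).
  by apply/cvg_incrementsP => e e0; exists e => // t _; rewrite sub0r normrN.
have H' : (fun t => t * partial_quotient f i x t + f x) @ increments A i x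
    --> 0 * d + f x by apply: cvgD; [exact: cvgM|exact: cvg_cst].
rewrite mul0r add0r in H'; apply: (cvg_trans _ H'); apply: near_eq_cvg.
apply/incrementsP; exists 1 => // t tn0 _ _.
by rewrite /partial_quotient /= [LHS]/= mulVKf// subrK.
Qed.

Lemma is_partial_val A f i x (d : R) : ProperFilter (increments A i x) ->
  is_partial A i f x d -> partial A i f x = d.
Proof. by move=> FF H; apply: cvg_lim H; exact: norm_hausdorff. Qed.

Lemma is_partial_cst A (c : R) i x : is_partial A i (fun=> c) x 0.
Proof. by apply: is_derive_is_partial; exact: is_derive_cst. Qed.

Lemma is_partialD A f h i x (c d : R) :
  is_partial A i f x c -> is_partial A i h x d ->
  is_partial A i (fun y => f y + h y) x (c + d).
Proof.
move=> fc hd; rewrite /is_partial.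
rewrite (_ : partial_quotient _ i x =
  partial_quotient f i x + partial_quotient h i x); first exact: cvgD.
by apply/funext => t; rewrite /partial_quotient [RHS]/= -mulrDr opprD addrACA.
Qed.

Lemma is_partialM A f h i x (c d : R) :
  is_partial A i f x c -> is_partial A i h x d ->
  is_partial A i (fun y => f y * h y) x (c * h x + f x * d).
Proof.
move=> fc hd; rewrite /is_partial.
rewrite (_ : partial_quotient _ i x = (fun t => partial_quotient f i x t *
    h (x + t *: delta_mx 0 i) + f x * partial_quotient h i x t)).
  by apply: cvgD; apply: cvgM => //; [exact: is_partial_cvg hd|exact: cvg_cst].
by apply/funext => t; rewrite /partial_quotient; ring.
Qed.

Lemma tail_sum_move x (t : R) i m : tail_sum (x + t *: delta_mx 0 i) m =
  tail_sum x m + (m <= i)%N%:R * t.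
Proof.
rewrite /tail_sum; under eq_bigr do rewrite coord_move.
rewrite big_split /= -mulr_sumr mulrC; congr (_ + _ * _).
have [mi|im] := leqP m i; last first.
  by rewrite big1// => l ml; case: eqP => // li; rewrite li leqNgt im in ml.
rewrite (bigD1 i)//= eqxx big1 ?addr0// => l /andP[_ /negbTE->//].
Qed.

Lemma is_partial_expR A (c : R) m i x :
  is_partial A i (fun y => expR (c * tail_sum y m)) x
    (c * (m <= i)%N%:R * expR (c * tail_sum x m)).
Proof.
apply: is_derive_is_partial; under eq_fun do rewrite tail_sum_move.
set T := tail_sum x m; set b := _%:R.
have H : is_derive (0 : R) 1 (fun t : R => c * (T + b * t)) (c * b).
  by apply: is_derive_eq; rewrite add0r mul1r /GRing.scale/= mulr1.
have := @is_derive1_comp R expR _ 0 _ _ (is_derive_expR _) H.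
by rewrite /= mulr0 addr0 mulrC.
Qed.

End PartialCalculus.

(** * Closure properties of the classes C^n on the closed orthant *)

Section Smoothness.
Variables (R : realType) (L : nat).
Local Notation V := 'rV[R]_L.
Implicit Types (A : set V) (f h : V -> R) (x : V) (i l : 'I_L).

Lemma within_continuous_ext A f h : (forall y, A y -> f y = h y) ->
  {within A, continuous f} -> {within A, continuous h}.
Proof.
move=> fh /within_continuousP cf; apply/within_continuousP => x Ax.
apply/within_cvgP => e e0; have /within_cvgP/(_ e e0)[d d0 H] := cf x Ax.
by exists d => // y Ay xy; rewrite -!fh//; exact: H.
Qed.

Lemma C_n_continuous A n f : C_n A n f -> {within A, continuous f}.
Proof. by case: n => [|n] []. Qed.

Lemma C_n_ext A n f h : (forall y, A y -> f y = h y) -> C_n A n f -> C_n A n h.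
Proof.
elim: n f h => [|n IH] f h fh [cf Hf].
  by split=> //; exact: within_continuous_ext cf.
split=> [|i]; first exact: within_continuous_ext cf.
have [pf Cf] := Hf i; split=> [x Ax|].
  by apply: cvgP; exact: (is_partial_ext Ax fh (pf x Ax)).
by apply: IH Cf => y Ay; exact: partial_ext.
Qed.

Lemma C_nS A n f : C_n A n.+1 f -> C_n A n f.
Proof.
elim: n f => [|n IH] f [cf Hf]; first by split.
by split=> // i; have [pf Cf] := Hf i; split=> //; exact: IH.
Qed.

(** [C_n] refers to the chosen limits [partial], while derivatives are computed as explicit
    functions [df]. Uniqueness of limits identifies the two on the orthant, and [C_n_ext] transfers
    regularity. *)
Lemma C_n_intro n f (df : 'I_L -> V -> R) : {within orthant, continuous f} ->
  (forall i x, orthant x -> is_partial orthant i f x (df i x)) ->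
  (forall i, C_n orthant n (df i)) -> C_n orthant n.+1 f.
Proof.
move=> cf pf Cdf; split=> // i; split=> [x Ox|].
  by apply: cvgP; exact: pf.
apply: C_n_ext (Cdf i) => x Ox; apply/esym/is_partial_val; last exact: pf.
exact: orthant_increments_proper.
Qed.

Lemma C_n_is_partial A n f i x : C_n A n.+1 f -> A x ->
  is_partial A i f x (partial A i f x).
Proof. by move=> [_ /(_ i)[+ _]] Ax => /(_ x Ax). Qed.

Lemma C_n_partial A n f i : C_n A n.+1 f -> C_n A n (partial A i f).
Proof. by move=> [_ /(_ i)[]]. Qed.

Lemma within_continuousD A f h :
  {within A, continuous f} -> {within A, continuous h} ->
  {within A, continuous (fun x => f x + h x)}.
Proof.
move=> /within_continuousP cf /within_continuousP ch.
by apply/within_continuousP => x Ax; apply: cvgD; [exact: cf|exact: ch].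
Qed.

Lemma within_continuousM A f h :
  {within A, continuous f} -> {within A, continuous h} ->
  {within A, continuous (fun x => f x * h x)}.
Proof.
move=> /within_continuousP cf /within_continuousP ch.
by apply/within_continuousP => x Ax; apply: cvgM; [exact: cf|exact: ch].
Qed.

Lemma C_nD n f h : C_n orthant n f -> C_n orthant n h ->
  C_n orthant n (fun x => f x + h x).
Proof.
elim: n f h => [|n IH] f h Cf Ch.
  split=> //; apply: within_continuousD.
    exact: (C_n_continuous Cf).
  exact: (C_n_continuous Ch).
apply: (C_n_intro (df := fun i x => partial orthant i f x + partial orthant i h x)).
- by apply: within_continuousD;
    [exact: (C_n_continuous Cf)|exact: (C_n_continuous Ch)].
- by move=> i x Ox; apply: is_partialD;
    [exact: (C_n_is_partial Cf Ox)|exact: (C_n_is_partial Ch Ox)].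
- move=> i; apply: IH; exact: C_n_partial.
Qed.

Lemma C_nM n f h : C_n orthant n f -> C_n orthant n h ->
  C_n orthant n (fun x => f x * h x).
Proof.
elim: n f h => [|n IH] f h Cf Ch.
  split=> //; apply: within_continuousM.
    exact: (C_n_continuous Cf).
  exact: (C_n_continuous Ch).
apply: (C_n_intro (df := fun i x =>
  partial orthant i f x * h x + f x * partial orthant i h x)).
- by apply: within_continuousM;
    [exact: (C_n_continuous Cf)|exact: (C_n_continuous Ch)].
- by move=> i x Ox; apply: is_partialM;
    [exact: (C_n_is_partial Cf Ox)|exact: (C_n_is_partial Ch Ox)].
(* In the product rule [f] and [h] also occur undifferentiated; these factors are taken one order
   lower. *)
- move=> i; apply: C_nD; apply: IH; try exact: C_nS.
  + exact: C_n_partial.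
  + exact: C_n_partial.
Qed.

Lemma C_n_cst n (c : R) : C_n orthant n (fun _ : V => c).
Proof.
have cc : {within (@orthant R L), continuous (fun _ : V => c)}.
  by apply/within_continuousP => x _; exact: cvg_cst.
elim: n c cc => [|n IH] c cc; first by split.
apply: (C_n_intro (df := fun _ _ => 0)) => //.
- by move=> i x _; exact: is_partial_cst.
- by move=> i; apply: IH; apply/within_continuousP => x _; exact: cvg_cst.
Qed.

(** Each partial derivative is a constant multiple of the function itself, so the induction closes.
    The entries of [g] and of the Jacobian are built from these exponentials. *)
Lemma C_n_expR n (c : R) m :
  C_n orthant n (fun x : V => expR (c * tail_sum x m)).
Proof.
have cc : {within (@orthant R L), continuous (fun x => expR (c * tail_sum x m))}.
  apply/within_continuousP => x _; apply: cvg_within_filter.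
  apply: (@cvg_comp _ _ _ (fun x : V => c * tail_sum x m) expR); last first.
    exact: continuous_expR.
  apply: cvgM; first exact: cvg_cst.
  rewrite /tail_sum; elim: (index_enum _) => [|l r IH].
    by under eq_fun do rewrite big_nil; rewrite big_nil; exact: cvg_cst.
  under eq_fun do rewrite big_cons; rewrite big_cons.
  by case: ifP => // _; apply: cvgD IH; exact: coord_continuous.
elim: n => [|n IH]; first by split.
apply: (C_n_intro (df := fun i x =>
  (c * (m <= i)%N%:R) * expR (c * tail_sum x m))) => //.
- by move=> i x _; exact: is_partial_expR.
- by move=> i; apply: C_nM => //; exact: C_n_cst.
Qed.

End Smoothness.

(** * Mean value theorem, Schwarz's theorem and chain rule on the closed orthant *)

Section OrthantCalculus.
Variables (R : realType) (L : nat).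
Local Notation V := 'rV[R]_L.
Implicit Types (f h : V -> R) (x y : V) (i j l : 'I_L).

(** At positive distance from [y] along the axis, coordinate [i] is positive and the derivative is
    two-sided, so the classical mean value theorem applies; at [y] itself only right continuity is
    required. *)
Lemma MVT_orthant_pos f y i (d : R) :
  (forall x, orthant x -> has_partial orthant i f x) ->
  orthant y -> 0 < d ->
  exists c, [/\ 0 < c, c < d & f (y + d *: delta_mx 0 i) - f y =
    partial orthant i f (y + c *: delta_mx 0 i) * d].
Proof.
move=> pf Oy d0.
have Omove (t : R) : 0 <= t -> orthant (y + t *: delta_mx 0 i).
  by move=> t0; apply/orthant_move => //; rewrite addr_ge0.
pose phi t := f (y + t *: delta_mx 0 i).
have dphi (t : R) : 0 < t ->
    is_derive t 1 phi (partial orthant i f (y + t *: delta_mx 0 i)).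
  move=> t0; have /cvg_incrementsP H := pf _ (Omove t (ltW t0)).
  suff H' : (fun h : R => h^-1 *: ((phi \o shift t) (h *: 1) - phi t)) @ 0^' -->
      partial orthant i f (y + t *: delta_mx 0 i).
    apply: DeriveDef; first exact: (cvgP _ H').
    by apply: cvg_lim H'; exact: norm_hausdorff.
  apply/cvgrPdist_lt => e /H[r r0 {}H]; rewrite /dnbhs /within.
  (* The cap [t] keeps [t + h] positive, so no increment in this ball leaves the orthant. *)
  apply/nbhs_ballP; exists (Num.min r t); first by rewrite /= lt_min r0.
  move=> h /=; rewrite -ball_normE /ball_ /= sub0r normrN lt_min => /andP[hr ht] h0.
  have -> : phi (h *: 1 + t) = f (y + t *: delta_mx 0 i + h *: delta_mx 0 i).
    by rewrite /phi [h *: 1]mulr1 -addrA -scalerDl [h + t]addrC.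
  apply: H => //; rewrite -addrA -scalerDl; apply: Omove.
  by move: ht; rewrite ltr_norml => /andP[? _]; rewrite addrC -lerBlDr sub0r ltW.
have cphi (t : R) : 0 < t -> {for t, continuous phi}.
  by move=> /dphi[dt _]; exact/differentiable_continuous/derivable1_diffP.
have [||c] := MVT d0 (f := phi)
  (df := fun t => partial orthant i f (y + t *: delta_mx 0 i)).
- by move=> t; rewrite in_itv /= => /andP[t0 _]; exact: dphi.
- apply/continuous_within_itvP => //; split.
  + by move=> t; rewrite in_itv /= => /andP[t0 _]; exact: cphi.
  + have /is_partial_cvg/cvg_incrementsP H := pf y Oy.
    rewrite /phi scale0r addr0; apply/cvgrPdist_lt => e /H[r r0 {}H].
    near=> t; apply: H.
    * by rewrite gt_eqF//; near: t; exact: nbhs_right_gt.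
    * by rewrite gtr0_norm; near: t; [exact: nbhs_right_lt|exact: nbhs_right_gt].
    * by apply: Omove; near: t; exact: nbhs_right_ge.
  + by apply: cvg_at_left_filter; exact: cphi.
- rewrite in_itv /= /phi scale0r addr0 subr0 => /andP[c0 cd] E.
  by exists c; split.
Unshelve. all: by end_near. Qed.

Lemma MVT_orthant f y i (d : R) :
  (forall x, orthant x -> has_partial orthant i f x) ->
  orthant y -> orthant (y + d *: delta_mx 0 i) ->
  exists c, [/\ `|c| <= `|d|, orthant (y + c *: delta_mx 0 i)
    & f (y + d *: delta_mx 0 i) - f y =
      partial orthant i f (y + c *: delta_mx 0 i) * d].
Proof.
move=> pf Oy Oyd; case: (ltgtP d 0) => [d0|d0|->]; last first.
- by exists 0; rewrite scale0r addr0 mulr0 subrr; split.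
- have [c [c0 cd E]] := MVT_orthant_pos pf Oy d0.
  exists c; split=> //; first by rewrite !gtr0_norm// ltW.
  by apply/orthant_move => //; rewrite addr_ge0// ltW.
(* For negative [d] the segment is traversed from its other end, with step [- d]. *)
- have [|c [c0 cd]] := MVT_orthant_pos pf Oyd (_ : 0 < - d).
    by rewrite oppr_gt0.
  rewrite -!addrA -!scalerDl subrr scale0r addr0 => E; exists (d + c); split.
  + by rewrite !ltr0_norm//; lra.
  + rewrite scalerDl addrA; apply/orthant_move => //; rewrite addr_ge0// ltW//.
  + by apply: oppr_inj; rewrite opprB E mulrN.
Qed.

(** A nonnegative translation maps the orthant into itself, so increments admissible at [y] stay
    admissible at the translated point. *)
Lemma is_partial_shift f y i j (h d : R) : orthant y -> 0 <= h ->
  is_partial orthant i f (y + h *: delta_mx 0 j) d ->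
  is_partial orthant i (fun z => f (z + h *: delta_mx 0 j)) y d.
Proof.
move=> Oy h0 /cvg_incrementsP H; apply/cvg_incrementsP => e /H[r r0 {}H].
exists r => // t t0 tr Ot; rewrite /partial_quotient addrAC; apply: H => //.
by rewrite addrAC; apply/orthant_move => //; rewrite addr_ge0.
Qed.

(** Two mean value steps: direction [i] for the difference of [f] across a step in direction [j],
    then direction [j] for the derivative of [f]. All corners lie in positive directions, hence in
    the orthant. The bound is [h + h] because both displacements add up when [i = j]. *)
Lemma corner_second_difference f x i j (h : R) : C_n orthant 2 f ->
  orthant x -> 0 < h ->
  exists p, [/\ orthant p, forall l, `|x 0 l - p 0 l| < h + h &
    (f (x + h *: delta_mx 0 i + h *: delta_mx 0 j) - f (x + h *: delta_mx 0 i))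
    - (f (x + h *: delta_mx 0 j) - f x) =
    partial orthant j (partial orthant i f) p * h * h].
Proof.
move=> Cf Ox h0.
have Omove y l (t : R) : orthant y -> 0 <= t -> orthant (y + t *: delta_mx 0 l).
  by move=> Oy t0; apply/orthant_move => //; rewrite addr_ge0.
(* The difference is written with a factor -1 so that the sum and product rules differentiate it. *)
pose F y := f (y + h *: delta_mx 0 j) + (-1) * f y.
have pF y : orthant y -> is_partial orthant i F y
    (partial orthant i f (y + h *: delta_mx 0 j) +
     (0 * f y + (-1) * partial orthant i f y)).
  move=> Oy; apply: is_partialD.
    apply: is_partial_shift; rewrite ?ltW//.
    by apply: (C_n_is_partial Cf); exact: Omove (ltW h0).
  by apply: is_partialM; [exact: is_partial_cst|exact: (C_n_is_partial Cf)].
have [|c [c0 ch]] := MVT_orthant_pos (f := F) (i := i) _ Ox h0.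
  by move=> y Oy; apply: cvgP; exact: pF.
have Oc := Omove x i c Ox (ltW c0).
rewrite (is_partial_val (orthant_increments_proper i Oc) (pF _ Oc)).
have [|d [d0 dh]] := MVT_orthant_pos (f := partial orthant i f) (i := j) _ Oc h0.
  by move=> y Oy; exact: (C_n_is_partial (C_n_partial i Cf)).
rewrite mul0r add0r mulN1r => -> E.
exists (x + c *: delta_mx 0 i + d *: delta_mx 0 j); split.
- exact: Omove (ltW _).
- move=> l; rewrite !coord_move -addrA opprD addrA subrr add0r normrN.
  by do 2 case: eqP => _; rewrite ?(mulr1, mulr0) ger0_norm; lra.
- by rewrite -E /F; ring.
Qed.

(** The second difference is symmetric in [i] and [j], so the two mixed derivatives take a common
    value at points [p] and [q] near [x]. By continuity both values at [x] are then within half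
    their distance of it, a contradiction if they differ. *)
Lemma partialC f x i j : C_n orthant 2 f -> orthant x ->
  partial orthant i (partial orthant j f) x =
  partial orthant j (partial orthant i f) x.
Proof.
move=> Cf Ox; set a := LHS; set b := RHS; apply/eqP/negPn/negP => ab.
have e0 : 0 < `|a - b| / 2 by rewrite divr_gt0// normr_gt0 subr_eq0.
have := C_n_continuous (C_n_partial i (C_n_partial j Cf)).
move=> /within_continuousP/(_ x Ox)/within_cvgP/(_ _ e0)[r r0 Hr].
have := C_n_continuous (C_n_partial j (C_n_partial i Cf)).
move=> /within_continuousP/(_ x Ox)/within_cvgP/(_ _ e0)[s s0 Hs].
(* Halved because [p] and [q] are only known to lie within [h + h] of [x]. *)
pose h := Num.min r s / 2.
have h0 : 0 < h by rewrite divr_gt0// lt_min r0.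
have hh : h + h = Num.min r s by rewrite /h; lra.
have [p [Op xp Ep]] := corner_second_difference j i Cf Ox h0.
have [q [Oq xq Eq]] := corner_second_difference i j Cf Ox h0.
have pr l : `|x 0 l - p 0 l| < r.
  by apply: lt_le_trans (xp l) _; rewrite hh ge_min lexx.
have qs l : `|x 0 l - q 0 l| < s.
  by apply: lt_le_trans (xq l) _; rewrite hh ge_min lexx orbT.
have {}Hr := Hr p Op pr; have {}Hs := Hs q Oq qs.
have E : partial orthant i (partial orthant j f) p =
    partial orthant j (partial orthant i f) q.
  move: Ep Eq; rewrite (addrAC x (h *: delta_mx 0 j)).
  move: (partial _ _ _ p) (partial _ _ _ q) => u v.
  move: (f (_ + _ + _)) (f (x + h *: delta_mx 0 i)) => w w'.
  move: (f (x + _)) (f x) => w2 w3 E1 E2.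
  apply: (mulIf (lt0r_neq0 h0)); apply: (mulIf (lt0r_neq0 h0)).
  by rewrite -E1 -E2; ring.
move: Hr Hs; rewrite -/a -/b E; move: (partial _ _ _ q) => v.
move: a b {ab e0 E} => a b; rewrite (distrC b) => av vb.
have := ltrD av vb; rewrite -splitr => /(le_lt_trans (ler_distD v a b)).
by rewrite ltxx.
Qed.

Lemma cvg_sum_ord (T : Type) (F : set_system T) {FF : Filter F}
    (u : 'I_L -> T -> R) (a : 'I_L -> R) : (forall l, u l @ F --> a l) ->
  (fun t => \sum_l u l t) @ F --> \sum_l a l.
Proof.
move=> ua; elim: (index_enum _) => [|l r IH].
  by under eq_fun do rewrite big_nil; rewrite big_nil; exact: cvg_cst.
by under eq_fun do rewrite big_cons; rewrite big_cons; exact: cvgD.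
Qed.

(* The increment is split along the coordinate axes; each intermediate point
   takes its coordinates from two points of the orthant, so it stays there. *)
Lemma orthant_chain_rule (F : set_system R) {FF : Filter F} f x
    (gamma : R -> V) (c : 'I_L -> R) : C_n orthant 1 f -> orthant x ->
  (\forall t \near F, orthant (gamma t)) ->
  (forall l, (fun t => gamma t 0 l) @ F --> x 0 l) ->
  (forall l, (fun t => t^-1 * (gamma t 0 l - x 0 l)) @ F --> c l) ->
  (fun t => t^-1 * (f (gamma t) - f x)) @ F -->
    \sum_l c l * partial orthant l f x.
Proof.
move=> Cf Ox Og cg dg.
pose mix m t : V := \row_l (if (l < m)%N then gamma t 0 l else x 0 l).
have mixS l t : mix l.+1 t = mix l t + (gamma t 0 l - x 0 l) *: delta_mx 0 l.
  apply/rowP => k; rewrite coord_move !mxE ltnS leq_eqVlt.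
  have [->|kl] := eqVneq k l; first by rewrite eqxx ltnn /= mulr1 addrC subrK.
  by rewrite (negbTE kl : (k == l :> nat) = false) /= mulr0 addr0.
(* Where coordinate [l] does not move, both sides of [qE] vanish for any [q]; the default is the
   limit that [q] must have. *)
pose q l t := if gamma t 0 l == x 0 l then partial orthant l f x
  else (f (mix l.+1 t) - f (mix l t)) / (gamma t 0 l - x 0 l).
have qE l t : f (mix l.+1 t) - f (mix l t) = (gamma t 0 l - x 0 l) * q l t.
  rewrite /q; case: eqP => [gx|/eqP gx].
    by rewrite mixS gx subrr scale0r addr0 subrr mul0r.
  by rewrite mulrC divfK// subr_eq0.
have -> : (fun t => t^-1 * (f (gamma t) - f x)) =
    (fun t => \sum_l (t^-1 * (gamma t 0 l - x 0 l)) * q l t).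
  apply/funext => t; have {1}-> : gamma t = mix L t.
    by apply/rowP => l; rewrite mxE ltn_ord.
  have {1}-> : x = mix 0 t by apply/rowP => l; rewrite mxE ltn0.
  rewrite -(telescope_sumr (fun m => f (mix m t)) (leq0n L)) big_mkord mulr_sumr.
  by apply: eq_bigr => l _; rewrite qE mulrA.
apply: cvg_sum_ord => l; apply: cvgM; first exact: dg.
apply/cvgrPdist_lt => e e0.
have := C_n_continuous (C_n_partial l Cf).
move=> /within_continuousP/(_ x Ox)/within_cvgP/(_ _ e0)[r r0 Hr].
have near_x : \forall t \near F, forall k, `|x 0 k - gamma t 0 k| < r.
  by apply: filter_forall => k; have /cvgrPdist_lt/(_ _ r0) := cg k.
near=> t.
have Ogt : orthant (gamma t) by near: t.
have gx : forall k, `|x 0 k - gamma t 0 k| < r by near: t.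
rewrite /q; case: eqP => [_|/eqP gxl]; first by rewrite subrr normr0.
have Omix m : orthant (mix m t).
  by move=> k; rewrite mxE; case: ifP => _; [exact: Ogt|exact: Ox].
have [|||d [dl Od E]] := MVT_orthant (f := f) (i := l) (y := mix l t)
  (d := gamma t 0 l - x 0 l).
- by move=> y Oy; exact: (C_n_is_partial Cf).
- exact: Omix.
- by rewrite -mixS; exact: Omix.
- rewrite mixS E mulfK ?subr_eq0//; apply: Hr => // k.
  rewrite coord_move mxE; have [->|kl] := eqVneq k l.
    rewrite ltnn mulr1 opprD addrA subrr add0r normrN.
    by apply: le_lt_trans dl _; rewrite distrC.
  by rewrite mulr0 addr0; case: ifP => _; rewrite ?subrr ?normr0.
Unshelve. all: by end_near. Qed.

End OrthantCalculus.

(** * The image of [g] and derivatives of functions composed with its inverse *)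

Section GImage.
Variables (R : realType) (L : nat) (sigma : R).
Hypothesis sigma_gt0 : 0 < sigma.
Local Notation V := 'rV[R]_L.
Implicit Types (f h : V -> R) (x y z : V) (i j l : 'I_L).

Let s2_gt0 : 0 < 2 * sigma. Proof. by rewrite mulr_gt0. Qed.
Let s2_neq0 : 2 * sigma != 0. Proof. by rewrite gt_eqF. Qed.

Lemma tail_sum_le x m n : orthant x -> (m <= n)%N ->
  tail_sum x n <= tail_sum x m.
Proof.
move=> Ox mn; rewrite /tail_sum !(big_mkcond (fun l : 'I_L => leq _ l)) /=.
apply: ler_sum => l _; case: ifP => [nl|_]; first by rewrite (leq_trans mn nl).
by case: ifP.
Qed.

Lemma g_orthant x : orthant x -> orthant (g sigma x).
Proof.
move=> Ox l; rewrite mxE divr_ge0 ?(ltW s2_gt0)// subr_ge0 ler_expR lerN2.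
by rewrite ler_pM2l// tail_sum_le.
Qed.

(** The logarithms telescope, starting from the empty tail at [L]. Tail sums decrease in the index,
    so the bound on the full sum keeps every argument of [ln] positive. *)
Lemma tail_sum_g_inv z m : orthant z -> 2 * sigma * tail_sum z 0 < 1 ->
  tail_sum (g_inv sigma z) m = - (ln (1 - 2 * sigma * tail_sum z m) / (2 * sigma)).
Proof.
move=> Oz z1; have pos n : 0 < 1 - 2 * sigma * tail_sum z n.
  rewrite subr_gt0; apply: le_lt_trans z1.
  by rewrite ler_pM2l// tail_sum_le.
have [n] := ubnP (L - m); elim: n m => // n IH m mn.
have [Lm|mL] := leqP L m.
  by rewrite !tail_sum_ge// mulr0 subr0 ln1 mul0r oppr0.
have -> : tail_sum (g_inv sigma z) m = g_inv sigma z 0 (Ordinal mL) +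
    tail_sum (g_inv sigma z) m.+1.
  by rewrite -[in LHS]/(nat_of_ord (Ordinal mL)) tail_sum_rec.
rewrite IH; last first.
  by rewrite subnS (leq_trans _ (mn : (_ <= n)%N)) // ltn_predL subn_gt0.
by rewrite mxE ln_div ?posrE//=; ring.
Qed.

(** The image is a simplex without its outer face, since [1 - 2 * sigma * tail_sum z 0] is an
    exponential on it. The strict inequality leaves room for small positive increments. *)
Lemma g_imageP z :
  g_image sigma z <-> orthant z /\ 2 * sigma * tail_sum z 0 < 1.
Proof.
split=> [[x Ox <-]|[Oz z1]].
  split; first exact: g_orthant.
  by rewrite -subr_gt0 tail_sum_g// expR_gt0.
have pos n : 0 < 1 - 2 * sigma * tail_sum z n.
  rewrite subr_gt0; apply: le_lt_trans z1.
  by rewrite ler_pM2l// tail_sum_le.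
exists (g_inv sigma z).
  move=> l; rewrite mxE divr_ge0 ?(ltW s2_gt0)// ln_ge0// ler_pdivlMr// mul1r.
  by rewrite lerD2l lerN2 ler_pM2l// tail_sum_le.
apply/rowP => l; rewrite mxE !tail_sum_g_inv// !mulrN !opprK.
rewrite ![2 * sigma * (_ / _)]mulrC !divfK// !lnK ?posrE//.
by rewrite [tail_sum z l]tail_sum_rec; field; rewrite gt_eqF.
Qed.

Lemma g_inv_orthant z : g_image sigma z -> orthant (g_inv sigma z).
Proof. by move=> [x Ox <-]; rewrite g_invK. Qed.

Lemma g_image_increments_proper z i : g_image sigma z ->
  ProperFilter (increments (g_image sigma) i z).
Proof.
move=> /g_imageP[Oz z1]; apply: increments_proper; near=> t.
have t0 : 0 <= t by near: t; exact: nbhs_right_ge.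
apply/g_imageP; split; first by apply/orthant_move => //; rewrite addr_ge0.
rewrite tail_sum_move leq0n mul1r mulrDr -ltrBrDl mulrC -ltr_pdivlMr//.
by near: t; apply: nbhs_right_lt; rewrite divr_gt0// subr_gt0.
Unshelve. all: by end_near. Qed.

Definition jacobian_tail i m x : R := (m <= i)%N%:R * expR (2 * sigma * tail_sum x m).

(* [jacobian_tail i m] is the derivative with respect to z_i of the tail sum
   E_m, so [image_partial i f] is the derivative of f o g^-1 with respect to z_i,
   pulled back by g.  It is locked so that conversion never unfolds nested
   occurrences down to limits. *)
Definition image_partial : 'I_L -> (V -> R) -> V -> R := locked (fun i f x =>
  \sum_(l < L) (jacobian_tail i l x - jacobian_tail i l.+1 x) * partial orthant l f x).

Lemma image_partialE i f x : image_partial i f x =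
  \sum_(l < L) (jacobian_tail i l x - jacobian_tail i l.+1 x) * partial orthant l f x.
Proof. by rewrite /image_partial -lock. Qed.

#[local] Existing Instance increments_filter.

Lemma increments_in A i x : \forall t \near increments A i x, A (x + t *: delta_mx 0 i).
Proof. by apply/incrementsP; exists 1. Qed.

(** On the image the tail sum has the closed form [psi], differentiable on both sides. The
    derivative of [ln] is taken at [exp (- 2 sigma E_m)], which produces the exponential in
    [jacobian_tail]. *)
Lemma is_partial_tail_sum_g_inv i m x : orthant x ->
  is_partial (g_image sigma) i (fun z => tail_sum (g_inv sigma z) m) (g sigma x)
    (jacobian_tail i m x).
Proof.
move=> Ox; set z := g sigma x.
have Gz : g_image sigma z by exists x.
pose psi (w : V) : R := - (ln (1 - 2 * sigma * tail_sum w m) / (2 * sigma)).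
apply: (@is_partial_ext _ _ _ psi) => // [w /g_imageP[Ow w1]|].
  by rewrite tail_sum_g_inv.
apply: is_derive_is_partial; rewrite /psi.
under eq_fun do rewrite tail_sum_move.
have Tz : 1 - 2 * sigma * tail_sum z m = expR (- (2 * sigma * tail_sum x m)).
  exact: tail_sum_g.
set b := (m <= i)%N%:R.
have H1 : is_derive (0 : R) 1
    (fun t : R => 1 - 2 * sigma * (tail_sum z m + b * t)) (- (2 * sigma * b)).
  by apply: is_derive_eq; rewrite !add0r !mul1r /GRing.scale/= mulr1.
have H2 : is_derive (1 - 2 * sigma * (tail_sum z m + b * 0)) 1 (@ln R)
    (expR (2 * sigma * tail_sum x m)).
  rewrite mulr0 addr0 Tz; apply: is_derive_eq.
    by apply: is_derive1_ln; exact: expR_gt0.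
  by rewrite expRN invrK.
have H3 := @is_derive1_comp R _ _ 0 _ _ H2 H1.
have H4 (w : R) : is_derive w 1 (fun u : R => - (u / (2 * sigma))) (- (2 * sigma)^-1).
  by apply: is_derive_eq; rewrite !scaler0 add0r /GRing.scale/= mulr1.
have := @is_derive1_comp R _ _ 0 _ _ (H4 _) H3.
rewrite (_ : - _ * _ = jacobian_tail i m x)//.
by rewrite /jacobian_tail -/b; field; rewrite gt_eqF.
Qed.

(** Chain rule along the curve [t -> g_inv (z + t e_i)], which stays in the orthant as long as the
    increment stays in the image. Each coordinate is a difference of consecutive tail sums. *)
Lemma is_partial_g_inv i f x : C_n orthant 1 f -> orthant x ->
  is_partial (g_image sigma) i (f \o g_inv sigma) (g sigma x) (image_partial i f x).
Proof.
move=> Cf Ox; set z := g sigma x.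
have Gz : g_image sigma z by exists x.
have zK : g_inv sigma z = x by rewrite g_invK.
have part l : is_partial (g_image sigma) i (fun w => g_inv sigma w 0 l) z
    (jacobian_tail i l x - jacobian_tail i l.+1 x).
  apply: (@is_partial_ext _ _ _ (fun w => tail_sum (g_inv sigma w) l +
      (-1) * tail_sum (g_inv sigma w) l.+1)) => // [w _|].
    by rewrite tail_sum_rec; ring.
  rewrite (_ : _ - _ = jacobian_tail i l x + (0 * tail_sum (g_inv sigma z) l.+1
     + (-1) * jacobian_tail i l.+1 x)); last by ring.
  apply: is_partialD; first exact: is_partial_tail_sum_g_inv.
  by apply: is_partialM; [exact: is_partial_cst|exact: is_partial_tail_sum_g_inv].
rewrite image_partialE /is_partial /partial_quotient /= zK.
apply: (@orthant_chain_rule _ _ _ _ _ _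
  (fun t => g_inv sigma (z + t *: delta_mx 0 i))) => //.
- by apply: filterS (increments_in _ _ _) => t /g_inv_orthant.
- by move=> l; have := is_partial_cvg (part l); rewrite zK.
- by move=> l; have := part l; rewrite /is_partial /partial_quotient zK.
Qed.

Lemma partial_g_inv i f x : C_n orthant 1 f -> orthant x ->
  partial (g_image sigma) i (f \o g_inv sigma) (g sigma x) = image_partial i f x.
Proof.
move=> Cf Ox; apply: is_partial_val; last exact: is_partial_g_inv.
by apply: g_image_increments_proper; exists x.
Qed.

End GImage.

(** * Calculus of the pulled back derivatives [D i] *)

Section ImagePartial.
Variables (R : realType) (L : nat) (sigma : R).
Hypothesis sigma_gt0 : 0 < sigma.
Local Notation V := 'rV[R]_L.
Local Notation smooth := (@smooth_on R L orthant).
Local Notation D := (image_partial sigma).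
Local Notation jac := (jacobian_tail sigma).
Local Notation d_ := (partial orthant).
Implicit Types (f h : V -> R) (x y : V) (i j l : 'I_L).

Lemma smooth_ext f h : (forall y, orthant y -> f y = h y) ->
  smooth f -> smooth h.
Proof. by move=> fh sf n; exact: C_n_ext fh (sf n). Qed.

Lemma smooth_cst (c : R) : smooth (fun=> c).
Proof. by move=> n; exact: C_n_cst. Qed.

Lemma smoothD f h : smooth f -> smooth h -> smooth (fun x => f x + h x).
Proof. by move=> sf sh n; exact: C_nD. Qed.

Lemma smoothM f h : smooth f -> smooth h -> smooth (fun x => f x * h x).
Proof. by move=> sf sh n; exact: C_nM. Qed.

Lemma smooth_scale (c : R) f : smooth f -> smooth (fun x => c * f x).
Proof. by move=> sf; apply: smoothM => //; exact: smooth_cst. Qed.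

Lemma smooth_sum (I : Type) (r : seq I) (F : I -> V -> R) :
  (forall k, smooth (F k)) -> smooth (fun x => \sum_(k <- r) F k x).
Proof.
move=> sF; elim: r => [|k r IH].
  by under eq_fun do rewrite big_nil; exact: smooth_cst.
by under eq_fun do rewrite big_cons; exact: smoothD.
Qed.

Lemma smooth_partial f i : smooth f -> smooth (d_ i f).
Proof. by move=> sf n; exact: C_n_partial. Qed.

Lemma smooth_expR (c : R) m : smooth (fun x => expR (c * tail_sum x m)).
Proof. by move=> n; exact: C_n_expR. Qed.

Lemma smooth_is_partial f i x : smooth f -> orthant x ->
  is_partial orthant i f x (d_ i f x).
Proof. by move=> sf; exact: (C_n_is_partial (sf 1%N)). Qed.

Lemma orthant_partial_val f i x (d : R) : orthant x ->
  is_partial orthant i f x d -> d_ i f x = d.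
Proof. by move=> Ox; apply: is_partial_val; exact: orthant_increments_proper. Qed.

Lemma smooth_jac i m : smooth (jac i m).
Proof. by apply: smooth_scale; exact: smooth_expR. Qed.

Lemma smooth_g j : smooth (fun x => g sigma x 0 j).
Proof.
apply: (@smooth_ext (fun x => (2 * sigma)^-1 *
   (expR (- (2 * sigma) * tail_sum x j.+1) +
    -1 * expR (- (2 * sigma) * tail_sum x j)))).
  by move=> y _; rewrite mxE mulN1r !mulNr mulrC.
by apply: smooth_scale; apply: smoothD; [|apply: smooth_scale]; exact: smooth_expR.
Qed.

Lemma smooth_image_partial f i : smooth f -> smooth (D i f).
Proof.
move=> sf; apply: (smooth_ext (fun y _ => esym (image_partialE sigma i f y))).
apply: smooth_sum => l; apply: smoothM; last exact: smooth_partial.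
apply: (@smooth_ext (fun x => jac i l x + -1 * jac i l.+1 x)).
  by move=> y _; rewrite mulN1r.
by apply: smoothD; [|apply: smooth_scale]; exact: smooth_jac.
Qed.

Lemma image_partial_ext f h i x : orthant x ->
  (forall y, orthant y -> f y = h y) -> D i f x = D i h x.
Proof.
move=> Ox fh; rewrite !image_partialE; apply: eq_bigr => l _.
by rewrite (partial_ext _ Ox fh).
Qed.

Lemma image_partial_cst (c : R) i x : orthant x -> D i (fun=> c) x = 0.
Proof.
move=> Ox; rewrite image_partialE big1// => l _.
by rewrite (orthant_partial_val Ox (@is_partial_cst _ _ _ c l x)) mulr0.
Qed.

Lemma image_partialD f h i x : smooth f -> smooth h -> orthant x ->
  D i (fun y => f y + h y) x = D i f x + D i h x.
Proof.
move=> sf sh Ox; rewrite !image_partialE -big_split; apply: eq_bigr => l _ /=.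
rewrite -mulrDr.
congr (_ * _); apply: orthant_partial_val => //.
by apply: is_partialD; exact: smooth_is_partial.
Qed.

Lemma image_partialM f h i x : smooth f -> smooth h -> orthant x ->
  D i (fun y => f y * h y) x = D i f x * h x + f x * D i h x.
Proof.
move=> sf sh Ox; rewrite !image_partialE mulr_suml mulr_sumr -big_split.
apply: eq_bigr => l _ /=.
rewrite (orthant_partial_val Ox (is_partialM (smooth_is_partial sf Ox)
  (smooth_is_partial sh Ox))).
by ring.
Qed.

Lemma image_partial_scale (c : R) f i x : smooth f -> orthant x ->
  D i (fun y => c * f y) x = c * D i f x.
Proof.
move=> sf Ox; rewrite image_partialM//; last exact: smooth_cst.
by rewrite image_partial_cst// mul0r add0r.
Qed.

Lemma image_partial_sum (I : Type) (r : seq I) (F : I -> V -> R) i x :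
  (forall k, smooth (F k)) -> orthant x ->
  D i (fun y => \sum_(k <- r) F k y) x = \sum_(k <- r) D i (F k) x.
Proof.
move=> sF Ox; elim: r => [|k r IH].
  under [X in D i X]eq_fun do rewrite big_nil.
  by rewrite big_nil image_partial_cst.
under [X in D i X]eq_fun do rewrite big_cons.
by rewrite big_cons image_partialD ?IH//; exact: smooth_sum.
Qed.

(** The gradient of the tail sum E_m is the indicator of [m <= l]; contracting it with the
    coefficients of [D i] leaves this sum. *)
Lemma telescope_from (a : nat -> R) m n :
  \sum_(l < n) (a l - a l.+1) * (m <= l)%N%:R = if (m <= n)%N then a m - a n else 0.
Proof.
elim: n => [|n IH]; first by rewrite big_ord0; case: m => //=; rewrite subrr.
rewrite big_ord_recr /= {}IH [(m <= n.+1)%N]leq_eqVlt ltnS.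
have [->|mn] := eqVneq m n.+1.
  by rewrite ltnn mulr0 addr0 subrr.
by case: leqP => _ /=; rewrite ?mulr1 ?mulr0 ?addr0// addrA subrK.
Qed.

Lemma image_partial_expR (c : R) i m x : orthant x ->
  D i (fun y => expR (c * tail_sum y m)) x =
  c * expR (c * tail_sum x m) * jac i m x.
Proof.
move=> Ox; transitivity (c * expR (c * tail_sum x m) *
    \sum_(l < L) (jac i l x - jac i l.+1 x) * (m <= l)%N%:R).
  rewrite image_partialE mulr_sumr; apply: eq_bigr => l _.
  by rewrite (orthant_partial_val Ox (@is_partial_expR _ _ _ c m l x)); ring.
congr (_ * _); rewrite (telescope_from (jac i ^~ x)).
have jac0 n : (L <= n)%N -> jac i n x = 0.
  move=> Ln; rewrite /jacobian_tail leqNgt (leq_trans (ltn_ord i) Ln) /=.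
  by rewrite mul0r.
(* The end term at [L] vanishes because [i < L]; if [m > L], both sides are zero. *)
by case: ifPn => [_|]; rewrite ?(jac0 L)// ?subr0// -ltnNge => /ltnW/jac0.
Qed.

Lemma image_partial_g i j x : orthant x ->
  D i (fun y => g sigma y 0 j) x = (i == j)%:R.
Proof.
move=> Ox; rewrite (@image_partial_ext _ (fun y => (2 * sigma)^-1 *
   (expR (- (2 * sigma) * tail_sum y j.+1) +
    -1 * expR (- (2 * sigma) * tail_sum y j))))//; last first.
  by move=> y _; rewrite mxE mulN1r !mulNr mulrC.
have se m := smooth_expR (- (2 * sigma)) m.
have sse m := smooth_scale (-1) (se m).
rewrite image_partial_scale ?image_partialD ?image_partial_scale//; last first.
  exact: smoothD.
rewrite !image_partial_expR// /jacobian_tail.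
(* The exponential in [jac] cancels the one in [g], leaving the indicators of [j <= i] and [j < i],
   whose difference is the Kronecker delta. *)
have eN m : - (2 * sigma) * expR (- (2 * sigma) * tail_sum x m) * ((m <= i)%N%:R *
    expR (2 * sigma * tail_sum x m)) = - (2 * sigma) * (m <= i)%N%:R.
  by rewrite -mulrA; congr (_ * _); rewrite mulrCA -expRD mulNr addNr expR0 mulr1.
rewrite !eN -val_eqE /= [in RHS]eq_sym eqn_leq.
have s0 : sigma != 0 by rewrite gt_eqF.
by case: (ltngtP j i) => _ /=; field.
Qed.

Lemma image_partial_jac i j m x : orthant x ->
  D i (jac j m) x = 2 * sigma * jac i m x * jac j m x.
Proof.
move=> Ox; rewrite /(jac j m) image_partial_scale ?image_partial_expR//; last first.
  exact: smooth_expR.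
by rewrite /jacobian_tail; ring.
Qed.

(** Separates first and second order parts: the former is symmetric in [i] and [j] term by term, the
    latter after exchanging the sums and applying Schwarz's theorem. *)
Lemma image_partial_comp f i j x : smooth f -> orthant x ->
  D i (D j f) x =
    \sum_(m < L) (2 * sigma * jac i m x * jac j m x
                  - 2 * sigma * jac i m.+1 x * jac j m.+1 x) * d_ m f x
    + \sum_(m < L) \sum_(l < L) (jac j m x - jac j m.+1 x) *
        (jac i l x - jac i l.+1 x) * d_ l (d_ m f) x.
Proof.
move=> sf Ox.
have sN m : smooth (fun y => -1 * jac j m y) by apply: smooth_scale; exact: smooth_jac.
have sB m : smooth (fun y => jac j m y - jac j m.+1 y).
  apply: (@smooth_ext (fun y => jac j m y + -1 * jac j m.+1 y)).
    by move=> y _; rewrite mulN1r.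
  by apply: smoothD => //; exact: smooth_jac.
rewrite (image_partial_ext i Ox (fun y _ => image_partialE sigma j f y)).
rewrite (@image_partial_sum _ _
  (fun (m : 'I_L) y => (jac j m y - jac j m.+1 y) * d_ m f y))//;
  last by move=> m; apply: smoothM => //; exact: smooth_partial.
rewrite -big_split; apply: eq_bigr => m _ /=.
rewrite image_partialM//; last exact: smooth_partial.
congr (_ * _ + _).
  rewrite (@image_partial_ext _ (fun y => jac j m y + -1 * jac j m.+1 y))//.
    rewrite image_partialD ?(image_partial_scale (-1)) ?image_partial_jac//;
      try exact: smooth_jac.
    by ring.
  by move=> y _; rewrite mulN1r.
by rewrite image_partialE mulr_sumr; apply: eq_bigr => l _; rewrite mulrA.
Qed.

Lemma image_partialC f i j x : smooth f -> orthant x ->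
  D i (D j f) x = D j (D i f) x.
Proof.
move=> sf Ox; rewrite !image_partial_comp//; congr (_ + _).
  by apply: eq_bigr => m _; ring.
rewrite exchange_big; apply: eq_bigr => l _; apply: eq_bigr => m _ /=.
by rewrite (partialC _ _ (sf 2%N) Ox); ring.
Qed.

(** For neighbours, [jac j m] and [jac i m] differ only at [m = j]. In the differences of
    consecutive coefficients this index appears twice, at [l = j] with sign plus and at [l = i] with
    sign minus. *)
Lemma image_partialB f i j x : j = i.+1 :> nat ->
  D j f x - D i f x = expR (2 * sigma * tail_sum x j) * (d_ j f x - d_ i f x).
Proof.
move=> ij; set W := expR _.
have jacB m : jac j m x - jac i m x = (m == j :> nat)%:R * W.
  rewrite /jacobian_tail -mulrBl /W.
  have -> : (m <= j)%N%:R - (m <= i)%N%:R = (m == j :> nat)%:R :> R.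
    by rewrite ij leq_eqVlt ltnS; case: eqP => [->|_] /=; rewrite ?ltnn ?subr0 ?subrr.
  by case: eqP => [->|_] //; rewrite !mul0r.
have delta l' : \sum_l (l == l')%:R * d_ l f x = d_ l' f x.
  rewrite (bigD1 l')//= eqxx mul1r big1 ?addr0// => l /negbTE->.
  by rewrite mul0r.
rewrite !image_partialE -(delta j) -(delta i) -!sumrB mulr_sumr; apply: eq_bigr => l _.
have -> : (l == j) = (l == j :> nat) by [].
have -> : (l == i) = (l.+1 == j :> nat) by rewrite ij eqSS.
rewrite -!mulrBl mulrA; congr (_ * _).
by rewrite mulrBr ![W * _]mulrC -!jacB; ring.
Qed.

End ImagePartial.

(** * The su(1,1) relations and the bond generators *)

Section Representation.
Variables (R : realType) (L : nat) (sigma k : R).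
Hypothesis sigma_gt0 : 0 < sigma.
Local Notation V := 'rV[R]_L.
Local Notation smooth := (@smooth_on R L orthant).
Local Notation D := (image_partial sigma).
Local Notation z_ := (fun i x => g sigma x 0 i).
Local Notation K := (@K_tilde R L sigma k).
Implicit Types (f h : V -> R) (x y : V) (i j l : 'I_L) (a b : su11_generator).

(** The form of [K_tilde] in terms of [D i], free of [g_inv]. All identities are proved for it and
    transferred on smooth functions. *)
Definition K_pulled a i f x : R :=
  match a with
  | Kplus => g sigma x 0 i * f x
  | Kminus => g sigma x 0 i * D i (D i f) x + 2 * k * D i f x
  | Ko => g sigma x 0 i * D i f x + k * f x
  end.

Lemma K_tildeE a i f x : smooth f -> orthant x -> K a i f x = K_pulled a i f x.
Proof.
move=> sf Ox; rewrite /K_tilde; case: a => /=.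
- by rewrite g_invK.
- rewrite (partial_g_inv sigma_gt0 i (sf 1%N) Ox); congr (_ * _ + _).
  have sDf := smooth_image_partial sigma i sf.
  (* The inner derivative equals [D i f] composed with [g_inv] on the image, which is all that the
     outer derivative sees. *)
  rewrite -(partial_g_inv sigma_gt0 i (sDf 1%N) Ox); apply: partial_ext.
    by exists x.
  by move=> _ [y Oy <-] /=; rewrite g_invK// (partial_g_inv sigma_gt0 i (sf 1%N) Oy).
- by rewrite (partial_g_inv sigma_gt0 i (sf 1%N) Ox) g_invK.
Qed.

Lemma smooth_K_pulled a i f : smooth f -> smooth (K_pulled a i f).
Proof.
have sg := smooth_g sigma i.
move=> sf; have sDf := smooth_image_partial sigma i sf.
have sDDf := smooth_image_partial sigma i sDf.
case: a; rewrite /K_pulled.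
- exact: smoothM.
- by apply: smoothD; [exact: smoothM|exact: smooth_scale].
- by apply: smoothD; [exact: smoothM|exact: smooth_scale].
Qed.

Lemma smooth_K_tilde a i f : smooth f -> smooth (K a i f).
Proof.
move=> sf; apply: smooth_ext (smooth_K_pulled a i sf) => x Ox.
by rewrite K_tildeE.
Qed.

Lemma K_pulled_ext a i f h x : orthant x ->
  (forall y, orthant y -> f y = h y) -> K_pulled a i f x = K_pulled a i h x.
Proof.
move=> Ox fh; have Dfh y : orthant y -> D i f y = D i h y.
  by move=> Oy; exact: image_partial_ext.
case: a; rewrite /K_pulled.
- by rewrite fh.
- by rewrite (image_partial_ext sigma i Ox Dfh) (Dfh x Ox).
- by congr (_ * _ + _ * _); [exact: Dfh|exact: fh].
Qed.

(** The inner operator may be replaced because [K_pulled] depends on a function only through its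
    values on the orthant. *)
Lemma K_tilde_comp a b i j f x : smooth f -> orthant x ->
  K a i (K b j f) x = K_pulled a i (K_pulled b j f) x.
Proof.
move=> sf Ox; rewrite K_tildeE//; last exact: smooth_K_tilde.
by apply: K_pulled_ext => // y Oy; exact: K_tildeE.
Qed.

Lemma K_pulledD a i f h x : smooth f -> smooth h -> orthant x ->
  K_pulled a i (fun y => f y + h y) x = K_pulled a i f x + K_pulled a i h x.
Proof.
move=> sf sh Ox; have DD y : orthant y ->
    D i (fun y => f y + h y) y = D i f y + D i h y.
  by move=> Oy; exact: image_partialD.
have [sDf sDh] := (smooth_image_partial sigma i sf, smooth_image_partial sigma i sh).
case: a; rewrite /K_pulled.
- exact: mulrDr.
- by rewrite (image_partial_ext _ _ Ox DD) (DD x Ox) image_partialD//; ring.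
- by rewrite (DD x Ox); ring.
Qed.

Lemma K_pulled_scale (c : R) a i f x : smooth f -> orthant x ->
  K_pulled a i (fun y => c * f y) x = c * K_pulled a i f x.
Proof.
move=> sf Ox; have DZ y : orthant y -> D i (fun y => c * f y) y = c * D i f y.
  by move=> Oy; exact: image_partial_scale.
have sDf := smooth_image_partial sigma i sf.
case: a; rewrite /K_pulled.
- exact: mulrCA.
- by rewrite (image_partial_ext _ _ Ox DZ) (DZ x Ox) image_partial_scale//; ring.
- by rewrite (DZ x Ox); ring.
Qed.

Lemma image_partial_gM i j f x : smooth f -> orthant x ->
  D i (fun y => g sigma y 0 j * f y) x =
  (i == j)%:R * f x + g sigma x 0 j * D i f x.
Proof.
move=> sf Ox; rewrite (@image_partialM _ _ _ (fun y => g sigma y 0 j))//.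
  by rewrite image_partial_g.
exact: smooth_g.
Qed.

(** Multiplication by [g_i] and the derivation [D i] are the building blocks of every operator at
    site [i]. An operator at another site commutes with the former because [D j] annihilates
    [g_i]. *)
Lemma K_pulled_gM b i j f x : i != j -> smooth f -> orthant x ->
  K_pulled b j (fun y => g sigma y 0 i * f y) x = g sigma x 0 i * K_pulled b j f x.
Proof.
move=> ij sf Ox; have sDf := smooth_image_partial sigma j sf.
have DgM h : smooth h -> forall y, orthant y ->
    D j (fun y => g sigma y 0 i * h y) y = g sigma y 0 i * D j h y.
  by move=> sh y Oy; rewrite image_partial_gM// eq_sym (negbTE ij) mul0r add0r.
case: b; rewrite /K_pulled.
- exact: mulrCA.
- by rewrite (image_partial_ext _ _ Ox (DgM f sf)) !DgM//; ring.
- by rewrite DgM//; ring.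
Qed.

Lemma K_pulled_image_partial b i j f x : i != j -> smooth f -> orthant x ->
  D i (K_pulled b j f) x = K_pulled b j (D i f) x.
Proof.
move=> ij sf Ox; have sDf := smooth_image_partial sigma j sf.
have sDDf := smooth_image_partial sigma j sDf.
have sg := smooth_g sigma j.
have DC y : orthant y -> D i (D j f) y = D j (D i f) y.
  by move=> Oy; exact: image_partialC.
case: b; rewrite /K_pulled.
- by rewrite image_partial_gM// (negbTE ij) mul0r add0r.
- rewrite image_partialD ?image_partial_gM ?image_partial_scale//; first last.
  + exact: smooth_scale.
  + exact: smoothM.
  rewrite (negbTE ij) mul0r add0r DC// image_partialC//.
  by rewrite (image_partial_ext _ _ Ox DC).
- rewrite image_partialD ?image_partial_gM ?image_partial_scale//; first last.
  + exact: smooth_scale.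
  + exact: smoothM.
  by rewrite (negbTE ij) mul0r add0r DC.
Qed.

Lemma K_pulledC a b i j f x : i != j -> smooth f -> orthant x ->
  K_pulled a i (K_pulled b j f) x = K_pulled b j (K_pulled a i f) x.
Proof.
move=> ij sf Ox; have sDf := smooth_image_partial sigma i sf.
have sDDf := smooth_image_partial sigma i sDf.
have sg := smooth_g sigma i.
have DK y : orthant y -> D i (K_pulled b j f) y = K_pulled b j (D i f) y.
  by move=> Oy; exact: K_pulled_image_partial.
(* Only the operator at site [i] is unfolded; the one at [j] is moved past its pieces as a whole. *)
case: a; rewrite {1}[LHS]/K_pulled {2}[in RHS]/K_pulled.
- by rewrite K_pulled_gM.
- rewrite K_pulledD ?K_pulled_gM ?K_pulled_scale//; first last.
  + exact: smooth_scale.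
  + exact: smoothM.
  by rewrite DK// (image_partial_ext _ _ Ox DK) K_pulled_image_partial.
- rewrite K_pulledD ?K_pulled_gM ?K_pulled_scale//; first last.
  + exact: smooth_scale.
  + exact: smoothM.
  by rewrite DK.
Qed.

Lemma K_pulled_Ko_Kplus i f x : smooth f -> orthant x ->
  K_pulled Ko i (K_pulled Kplus i f) x - K_pulled Kplus i (K_pulled Ko i f) x =
  K_pulled Kplus i f x.
Proof.
by move=> sf Ox; rewrite /K_pulled /= image_partial_gM// eqxx mul1r; ring.
Qed.

Lemma K_pulled_Kminus_Kplus i f x : smooth f -> orthant x ->
  K_pulled Kminus i (K_pulled Kplus i f) x - K_pulled Kplus i (K_pulled Kminus i f) x =
  2 * K_pulled Ko i f x.
Proof.
move=> sf Ox; have sDf := smooth_image_partial sigma i sf.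
have sg := smooth_g sigma i.
have DgM y : orthant y ->
    D i (fun y => g sigma y 0 i * f y) y = f y + g sigma y 0 i * D i f y.
  by move=> Oy; rewrite image_partial_gM// eqxx mul1r.
rewrite /K_pulled /= DgM// (image_partial_ext _ _ Ox DgM) image_partialD//.
  by rewrite image_partial_gM// eqxx mul1r; ring.
exact: smoothM.
Qed.

Lemma K_pulled_Ko_Kminus i f x : smooth f -> orthant x ->
  K_pulled Ko i (K_pulled Kminus i f) x - K_pulled Kminus i (K_pulled Ko i f) x =
  - K_pulled Kminus i f x.
Proof.
move=> sf Ox; have sDf := smooth_image_partial sigma i sf.
have sDDf := smooth_image_partial sigma i sDf.
have sg := smooth_g sigma i.
have DKo y : orthant y -> D i (fun y => g sigma y 0 i * D i f y + k * f y) y =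
    (1 + k) * D i f y + g sigma y 0 i * D i (D i f) y.
  move=> Oy; rewrite image_partialD ?image_partial_gM ?image_partial_scale//; first last.
  + exact: smooth_scale.
  + exact: smoothM.
  by rewrite eqxx mul1r; ring.
rewrite /K_pulled /= DKo// (image_partial_ext _ _ Ox DKo).
rewrite !image_partialD ?image_partial_gM ?image_partial_scale//;
  try (by [exact: smoothM|exact: smooth_scale]).
by rewrite eqxx mul1r; ring.
Qed.

Lemma su11_representation_K_tilde : su11_representation orthant K.
Proof.
split.
- move=> a i; split=> [f|c f h sf sh x]; first exact: smooth_K_tilde.
  rewrite inE => Ox; have scf := smooth_scale c sf.
  by rewrite !K_tildeE ?K_pulledD ?K_pulled_scale//; exact: smoothD.
- move=> i f sf x; rewrite inE => Ox.
  by rewrite /commutator !K_tilde_comp// K_tildeE// K_pulled_Ko_Kplus.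
- move=> i f sf x; rewrite inE => Ox.
  by rewrite /commutator !K_tilde_comp// K_tildeE// K_pulled_Ko_Kminus.
- move=> i f sf x; rewrite inE => Ox.
  by rewrite /commutator !K_tilde_comp// K_tildeE// K_pulled_Kminus_Kplus.
- move=> a b i j ij f sf x; rewrite inE => Ox.
  by rewrite /commutator !K_tilde_comp// K_pulledC// subrr.
Qed.

(** The product of the two [Ko] contributes [-2 * k ^+ 2 * f], which the added constant cancels.
    What remains is the bond generator of the Brownian energy process in the variables z. *)
Lemma K_pulled_bond i j f x : i != j -> smooth f -> orthant x ->
  K_pulled Kplus i (K_pulled Kminus j f) x
  + K_pulled Kminus i (K_pulled Kplus j f) x
  - 2 * K_pulled Ko i (K_pulled Ko j f) x + 2 * k ^+ 2 * f x =
  g sigma x 0 i * g sigma x 0 j *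
    (D i (D i f) x - D i (D j f) x - (D j (D i f) x - D j (D j f) x))
  - 2 * k * (g sigma x 0 i - g sigma x 0 j) * (D i f x - D j f x).
Proof.
move=> ij sf Ox; have ji : j != i by rewrite eq_sym.
rewrite (K_pulled_gM Kminus ji sf Ox) [K_pulled Ko i _ x]/=.
rewrite K_pulled_image_partial//= (image_partialC sigma i j sf Ox).
by ring.
Qed.

(** With [w = exp (- 2 sigma E_j)], d/dx_i - d/dx_j is [w (D_i - D_j)]. In its square the derivative
    of [w] gives a first order term that cancels the drift [(1 - u) * (v - 1)]; the other drift
    follows from [g_i - g_j = w (2 - u - v) / (2 sigma)]. *)
Lemma ABEP_bond_image_partial i j f x : j = i.+1 :> nat -> smooth f -> orthant x ->
  ABEP_bond sigma k i j f x =
  g sigma x 0 i * g sigma x 0 j *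
    (D i (D i f) x - D i (D j f) x - (D j (D i f) x - D j (D j f) x))
  - 2 * k * (g sigma x 0 i - g sigma x 0 j) * (D i f x - D j f x).
Proof.
move=> ij sf Ox; pose w y := expR (- (2 * sigma) * tail_sum y j).
have dE h y : partial_diff orthant i j h y = w y * (D i h y + -1 * D j h y).
  rewrite mulN1r -opprB (image_partialB sigma h y ij) /w mulrN mulrA.
  by rewrite -expRD mulNr addNr expR0 mul1r opprB.
have sD l := smooth_image_partial sigma l sf.
have sP : smooth (fun y => D i f y + -1 * D j f y).
  by apply: smoothD => //; exact: smooth_scale.
have sw : smooth w by exact: smooth_expR.
have Diw : D i w x = 0.
  by rewrite image_partial_expR// /jacobian_tail ij ltnn mul0r mulr0.
have Djw : D j w x = - (2 * sigma).
  rewrite image_partial_expR// /jacobian_tail leqnn mul1r -[RHS]mulr1.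
  rewrite -[LHS]mulrA; congr (_ * _).
  by rewrite -expRD mulNr addNr expR0.
have DlE l : D l (partial_diff orthant i j f) x =
    D l w x * (D i f x - D j f x) + w x * (D l (D i f) x - D l (D j f) x).
  rewrite (image_partial_ext sigma l Ox (fun y _ => dE f y)) image_partialM//.
  by rewrite image_partialD ?image_partial_scale ?mulN1r//; exact: smooth_scale.
(* As [j = i + 1], E_j is the lower tail sum in [g_i] and the upper one in [g_j], so both share the
   factor [w]. *)
have wi : g sigma x 0 i = w x * (1 - expR (- (2 * sigma * x 0 i))) / (2 * sigma).
  rewrite mxE -ij [tail_sum x i]tail_sum_rec -ij mulrBr mulr1 /w -expRD.
  by congr ((expR _ - expR _) / _); ring.
have wj : g sigma x 0 j = w x * (expR (2 * sigma * x 0 j) - 1) / (2 * sigma).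
  rewrite mxE mulrBr mulr1 /w -expRD [tail_sum x j]tail_sum_rec.
  by congr ((expR _ - expR _) / _); ring.
rewrite /ABEP_bond dE !DlE Diw Djw dE wi wj.
have s0 : sigma != 0 by rewrite gt_eqF.
by field.
Qed.

End Representation.

Theorem theorem3p5 (R : realType) (L : nat) (sigma k : R)
    (hL : (2 <= L)%N) (hsigma : 0 < sigma) (hk : 0 <= k) :
  eq_on_smooth orthant (@ABEP_generator R L sigma k)
    (fun f x =>
       \sum_(i < L) \sum_(j < L | j == i.+1 :> nat)
         (K_tilde sigma k Kplus i (K_tilde sigma k Kminus j f) x
          + K_tilde sigma k Kminus i (K_tilde sigma k Kplus j f) x
          - 2 * K_tilde sigma k Ko i (K_tilde sigma k Ko j f) x
          + 2 * k ^+ 2 * f x)) /\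
  su11_representation orthant (@K_tilde R L sigma k).
Proof.
split; last exact: su11_representation_K_tilde.
move=> f sf x; rewrite inE => Ox; apply: eq_bigr => i _; apply: eq_bigr => j /eqP ij.
(* Bond by bond, both sides reduce to the same expression in [g] and [D]. *)
rewrite !K_tilde_comp// K_pulled_bond ?ABEP_bond_image_partial//.
by rewrite -val_eqE /= ij ltn_eqF.
Qed.
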